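(* Let $r,s\in C^1[0,\infty)$, $u\in C[0,\infty)$ be real-valued with $r(t)>0$, $s(t)>0$ for all $t\ge0$, and suppose that one of the following holds, where $\{W_t\}_{t\ge0}$ is the indicated family of weight functions on the indicated set $X$: (i) $\dot s=2ur$, $\dot r=-2us$, $\operatorname{sgn}u(t)=\operatorname{sgn}r(t)$ for $t>0$; $j\in\frac12\mathbb N$, $X=\{0,\dots,2j\}$, $W_t(x)=\binom{2j}xp(t)^x(1-p(t))^{2j-x}$ with $p(t)=\frac12+\frac{s(t)}{2C}$, $C=\sqrt{s^2+r^2}$; (ii) $\dot s=-2ur$, $\dot r=-2us$, $\operatorname{sgn}u(t)=-\operatorname{sgn}r(t)$ for $t>0$, $s^2-r^2>0$; $k>0$, $X=\mathbb N$, $W_t(x)=\frac{(2k)_x}{x!}c(t)^x(1-c(t))^{2k}$ with $c(t)=e^{-2\operatorname{arccosh}(s(t)/r(t))}$; (iii) $\dot s=-2ur$, $\dot r=-2us$, $\operatorname{sgn}u(t)=-\operatorname{sgn}r(t)$ for $t>0$, $s^2-r^2=0$; $k>0$, $X=[0,\infty)$, $W_t(x)=\frac{x^{2k-1}r(t)^{-2k}e^{-x/r(t)}}{\Gamma(2k)}$; (iv) $\dot s=-2ur$, $\dot r=-2us$, $\operatorname{sgn}u(t)=-\operatorname{sgn}r(t)$ for $t>0$, $s^2-r^2<0$; $k>0$, $X=\mathbb R$, $W_t(x)=\frac{(2\sin\phi(t))^{2k}}{2\pi\Gamma(2k)}e^{(2\phi(t)-\pi)x}|\Gamma(k+ix)|^2$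 with $\phi(t)=\arccos(s(t)/r(t))$; (v) $c\in\mathbb R\setminus\{0\}$, $\dot s=2ru$, $\dot r=-2cu$, $\operatorname{sgn}u(t)=\operatorname{sgn}r(t)$ for $t>0$; $h>0$, $X=\mathbb N$, $W_t(x)=\frac1{x!}\big(\frac{hr(t)^2}{4c^2}\big)^xe^{-hr(t)^2/(4c^2)}$; (vi) $\dot s=2ru$, $\dot r=0$, $\operatorname{sgn}u(t)=\operatorname{sgn}r(t)$ for $t>0$; $h>0$, $X=\mathbb R$, $W_t(x)=\frac1{r\sqrt{2h\pi}}e^{-\frac{(x+hs(t))^2}{2hr^2}}$. Then there is a function $m:[0,\infty)\to(0,\infty)$ with $m(0)=1$, and numbers $K_t$ independent of $x$, such that $$W_t(x)=K_t\,W_0(x)\,m(t)^x,\qquad x\in X,\ t\ge0,$$ and there exists a constant $K$ (independent of $t$) such that $$m(t)=\exp\Big(K\int_0^t\frac{u(\tau)}{r(\tau)}\,d\tau\Big),\qquad t\ge0.$$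
   Context: $\mathbb N=\{0,1,2,\dots\}$ and $(a)_n=a(a+1)\cdots(a+n-1)$. The six cases are the orthogonality measures of the $t$-dependent (Krawtchouk, Meixner, Laguerre, Meixner-Pollaczek, Charlier, Hermite) polynomials that diagonalize the Lax operator $L(t)$ acting as a finite or semi-infinite Jacobi matrix in representations of $\mathfrak{su}(2)$ (case (i)), $\mathfrak{su}(1,1)$ (cases (ii)-(iv)) and the oscillator algebra $\mathfrak b(1)$ (cases (v),(vi)). The function $m$ is called the modification function. *)

(* Defs.v *)
From HB Require Import structures.
From mathcomp Require Import all_boot all_order all_algebra.
From mathcomp Require Import all_classical all_reals all_analysis.
From mathcomp Require Import complex.

Set Implicit Arguments.
Unset Strict Implicit.
Unset Printing Implicit Defensive.

Import Order.TTheory GRing.Theory Num.Theory.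
Import numFieldNormedType.Exports.

Local Open Scope classical_set_scope.
Local Open Scope ring_scope.

(* The limit of the difference quotient is taken inside A, so that on
   A = [0, +oo[ the derivative at the end point 0 is the one-sided one. *)
Definition has_deriv_on (R : realType) (A : set R) (f f' : R -> R) : Prop :=
  forall t, A t ->
    (f x - f t) / (x - t) @[x --> within A (t^')] --> f' t.

Definition C0_on (R : realType) (A : set R) (f : R -> R) : Prop :=
  {within A, continuous f}.

Definition C1_on (R : realType) (A : set R) (f : R -> R) : Prop :=
  exists2 f' : R -> R, has_deriv_on A f f' & C0_on A f'.

Definition pochhammer (R : realType) (a : R) (n : nat) : R :=
  \prod_(i < n) (a + i%:R).

Definition cosh (R : realType) (x : R) : R := (expR x + expR (- x)) / 2.

(* The nonnegative inverse branch of cosh, meaningful for 1 <= y. *)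
Definition arccosh (R : realType) (y : R) : R := ln (y + Num.sqrt (y ^+ 2 - 1)).

Lemma arccoshP (R : realType) (y : R) :
  1 <= y -> 0 <= arccosh y /\ cosh (arccosh y) = y.
Proof.
move=> y1; rewrite /arccosh; set q := Num.sqrt _.
have q0 : 0 <= q by exact: sqrtr_ge0.
have yq1 : 1 <= y + q by rewrite (le_trans y1)// lerDl.
have yq0 : 0 < y + q by rewrite (lt_le_trans _ yq1).
split; first exact: ln_ge0.
have q2 : q ^+ 2 = y ^+ 2 - 1.
  by rewrite sqr_sqrtr// subr_ge0 expr_ge1// (le_trans _ y1).
have yqV : (y + q)^-1 = y - q.
  apply: (mulfI (lt0r_neq0 yq0)); rewrite divff ?lt0r_neq0//.
  by rewrite mulrC -subr_sqr q2 opprB addrCA subrr addr0.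
rewrite /cosh expRN lnK ?posrE// yqV addrACA subrr addr0.
by rewrite -[y + y]mulr2n -[y *+ 2]mulr_natr mulfK ?pnatr_eq0.
Qed.

(* Euler's integral int_0^oo y^(z - 1) e^(- y) dy for 0 < Re z, split into real
   and imaginary parts by means of
   y^(a + i b - 1) = y^(a - 1) (cos (b ln y) + i sin (b ln y)). *)
Definition Gamma (R : realType) (z : R[i]) : R[i] :=
  Complex
    (\int[lebesgue_measure]_(y in `]0, +oo[)
       (y `^ (complex.Re z - 1) * cos (complex.Im z * ln y) * expR (- y)))
    (\int[lebesgue_measure]_(y in `]0, +oo[)
       (y `^ (complex.Re z - 1) * sin (complex.Im z * ln y) * expR (- y))).

Definition rGamma (R : realType) (a : R) : R := complex.Re (Gamma (Complex a 0)).

(* In each case W t is only specified on X and for 0 <= t; subsets of the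
   naturals are viewed as sets of reals. *)

(* N stands for 2j, where j is a nonnegative half-integer. *)
Definition krawtchouk_case (R : realType) (r s u : R -> R)
    (X : set R) (W : R -> R -> R) : Prop :=
  let C t := Num.sqrt (s t ^+ 2 + r t ^+ 2) in
  let p t := 2^-1 + s t / (2 * C t) in
  [/\ has_deriv_on `[0, +oo[ s (fun t => 2 * u t * r t),
      has_deriv_on `[0, +oo[ r (fun t => - 2 * u t * s t),
      (forall t, 0 < t -> Num.sg (u t) = Num.sg (r t)) &
      exists N : nat,
        X = [set x%:R | x in [set x : nat | (x <= N)%N]] /\
        (forall (t : R) (x : nat), 0 <= t -> (x <= N)%N ->
           W t x%:R = 'C(N, x)%:R * p t ^+ x * (1 - p t) ^+ (N - x))].

Definition su11_flow (R : realType) (r s u : R -> R) : Prop :=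
  [/\ has_deriv_on `[0, +oo[ s (fun t => - 2 * u t * r t),
      has_deriv_on `[0, +oo[ r (fun t => - 2 * u t * s t) &
      forall t, 0 < t -> Num.sg (u t) = - Num.sg (r t)].

Definition meixner_case (R : realType) (r s u : R -> R)
    (X : set R) (W : R -> R -> R) : Prop :=
  let c t := expR (- 2 * arccosh (s t / r t)) in
  [/\ su11_flow r s u,
      (forall t, 0 <= t -> 0 < s t ^+ 2 - r t ^+ 2) &
      exists k : R,
        [/\ 0 < k, X = [set x%:R | x in [set: nat]] &
            forall (t : R) (x : nat), 0 <= t ->
              W t x%:R = pochhammer (2 * k) x / (x`!)%:R
                         * c t ^+ x * (1 - c t) `^ (2 * k)]].

(* At x = 0 the weight is infinite if 2k < 1, whereas 0 `^ (2k - 1) = 0. *)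
Definition laguerre_case (R : realType) (r s u : R -> R)
    (X : set R) (W : R -> R -> R) : Prop :=
  [/\ su11_flow r s u,
      (forall t, 0 <= t -> s t ^+ 2 - r t ^+ 2 = 0) &
      exists k : R,
        [/\ 0 < k, X = [set` `[0, +oo[] &
            forall t x : R, 0 <= t -> 0 <= x ->
              W t x = x `^ (2 * k - 1) * r t `^ (- (2 * k)) * expR (- x / r t)
                      / rGamma (2 * k)]].

Definition meixner_pollaczek_case (R : realType) (r s u : R -> R)
    (X : set R) (W : R -> R -> R) : Prop :=
  let phi t := acos (s t / r t) in
  [/\ su11_flow r s u,
      (forall t, 0 <= t -> s t ^+ 2 - r t ^+ 2 < 0) &
      exists k : R,
        [/\ 0 < k, X = [set: R] &
            forall t x : R, 0 <= t ->
              W t x = (2 * sin (phi t)) `^ (2 * k) / (2 * pi * rGamma (2 * k))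
                      * expR ((2 * phi t - pi) * x)
                      * ComplexField.Normc.normc (Gamma (Complex k x)) ^+ 2]].

Definition charlier_case (R : realType) (r s u : R -> R)
    (X : set R) (W : R -> R -> R) : Prop :=
  exists2 c : R, c != 0 &
  [/\ has_deriv_on `[0, +oo[ s (fun t => 2 * r t * u t),
      has_deriv_on `[0, +oo[ r (fun t => - 2 * c * u t),
      (forall t, 0 < t -> Num.sg (u t) = Num.sg (r t)) &
      exists h : R,
        [/\ 0 < h, X = [set x%:R | x in [set: nat]] &
            forall (t : R) (x : nat), 0 <= t ->
              W t x%:R = (x`!)%:R^-1 * (h * r t ^+ 2 / (4 * c ^+ 2)) ^+ x
                         * expR (- (h * r t ^+ 2 / (4 * c ^+ 2)))]].

Definition hermite_case (R : realType) (r s u : R -> R)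
    (X : set R) (W : R -> R -> R) : Prop :=
  [/\ has_deriv_on `[0, +oo[ s (fun t => 2 * r t * u t),
      has_deriv_on `[0, +oo[ r (fun=> 0),
      (forall t, 0 < t -> Num.sg (u t) = Num.sg (r t)) &
      exists h : R,
        [/\ 0 < h, X = [set: R] &
            forall t x : R, 0 <= t ->
              W t x = (r t * Num.sqrt (2 * h * pi))^-1
                      * expR (- ((x + h * s t) ^+ 2 / (2 * h * r t ^+ 2)))]].

(* Main.v *)
Require Import Defs.
From HB Require Import structures.
From mathcomp Require Import all_boot all_order all_algebra.
From mathcomp Require Import all_classical all_reals all_analysis.
From mathcomp Require Import ring lra.

(** In every case W_t(x) is a factor free of x times g(x) exp(x L(t)), with g free
    of t, so m(t) = exp(L(t) - L(0)).  The flow conserves s^2 + r^2 in case (i),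
    s^2 - r^2 in cases (ii)-(iv) and r in case (vi); with C the square root of the
    absolute value of this quantity in (i), (ii) and (iv), L is
    ln((C + s)/(C - s)), -2 ln((s + C)/r), -1/r, 2 arccos(s/r),
    ln(h r^2/(4 c^2)), -s/r^2 respectively, and L' = K u/r with
    K = 4C, -4C, -2, 4C, -4c, -2. *)

Set Implicit Arguments.
Unset Strict Implicit.
Unset Printing Implicit Defensive.

Import Order.TTheory GRing.Theory Num.Theory.
Import numFieldNormedType.Exports.

Local Open Scope classical_set_scope.
Local Open Scope ring_scope.

(** * Continuity and two-sided derivatives from one-sided difference quotients *)

Lemma has_deriv_on_continuous (R : realType) (A : set R) (f f' : R -> R) :
  has_deriv_on A f f' -> {within A, continuous f}.
Proof.
move=> df; apply/subspace_continuousP => t At.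
(* Off [t] this expression is [f x], and its last factor tends to 0. The point [x = t], which the
   punctured filter omits, is treated apart below. *)
have fq : f t + (f x - f t) / (x - t) * (x - t) @[x --> within A t^'] --> f t.
  rewrite -[X in _ --> X]addr0 -[X in _ + X](mulr0 (f' t)).
  apply: cvgD; first exact: cvg_cst.
  apply: cvgM; first exact: df.
  rewrite -[X in _ --> X](subrr t).
  apply: cvgB; last exact: cvg_cst.
  apply: cvg_within_filter; apply: cvg_within_filter; exact: cvg_id.
apply/cvgrPdist_lt => e e0.
move/cvgrPdist_lt : fq => /(_ e e0).
rewrite !near_withinE => H.
near=> x => Ax.
have [->|xt] := eqVneq x t; first by rewrite subrr normr0.
have : x != t -> A x -> `|f t - (f t + (f x - f t) / (x - t) * (x - t))| < e.
  near: x; exact: H.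
by move=> /(_ xt Ax); rewrite divfK ?subr_eq0// subrKC.
Unshelve. all: by end_near. Qed.

(** Near an interior point the restriction to [A] is vacuous, and [x = h + t] turns one quotient
    into the other. *)
Lemma has_deriv_on_is_derive (R : realType) (A : set R) (f f' : R -> R) (t : R) :
  nbhs t A -> has_deriv_on A f f' -> is_derive t 1 f (f' t).
Proof.
move=> At df.
suff q : h^-1 *: (f (h *: 1 + t) - f t) @[h --> 0^'] --> f' t.
  by apply: DeriveDef; [apply/cvg_ex; exists (f' t) | exact: cvg_lim q].
apply/cvgrPdist_lt => e e0.
have := df t (nbhs_singleton At) => /cvgrPdist_lt/(_ e e0).
rewrite !near_withinE => H.
have {}H : \forall x \near t, x != t -> `|f' t - (f x - f t) / (x - t)| < e.
  by near=> x => xt; have : A x; [near: x | move: xt; near: x].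
have /nbhs_ballP[d /= d0 dH] := H.
apply/nbhs_ballP; exists d => //= h; rewrite /ball/= sub0r normrN => hd h0.
have := dH (h + t); rewrite /ball/= opprD addrC subrK normrN => /(_ hd).
rewrite -subr_eq0 addrK => /(_ h0).
by rewrite [h *: 1]mulr1 mulrC.
Unshelve. all: by end_near. Qed.

(** These are exactly the conditions under which the fundamental theorem of calculus applies on
    [[0, t]]. The end point 0 carries continuity only, so the rules below use two-sided derivatives
    throughout. *)
Record deriv_halfline (R : realType) (f f' : R -> R) : Prop := DerivHalfline {
  halfline_is_derive : forall t : R, 0 < t -> is_derive t 1 f (f' t) ;
  halfline_continuous : {within `[0, +oo[, continuous f} }.

(** * Differentiation rules and the fundamental theorem on the half-line *)

Section halfline.
Context {R : realType}.
Implicit Types f g df dg : R -> R.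

Lemma has_deriv_on_halfline f df :
  has_deriv_on `[0, +oo[ f df -> deriv_halfline f df.
Proof.
move=> fdf; split; last exact: has_deriv_on_continuous fdf.
move=> t t0; apply: has_deriv_on_is_derive fdf.
by near=> x; rewrite /= in_itv/= andbT; apply: ltW; near: x; exact: lt_nbhsr.
Unshelve. all: by end_near. Qed.

Lemma deriv_halfline_eq f df dg :
  (forall t, 0 < t -> df t = dg t) -> deriv_halfline f df -> deriv_halfline f dg.
Proof. by move=> e [d c]; split => // t t0; rewrite -e//; exact: d. Qed.

Lemma deriv_halfline_cst (a : R) : deriv_halfline (fun=> a) (fun=> 0).
Proof. by split=> [t _|t]; [exact: is_derive_cst|exact: cvg_cst]. Qed.

Lemma deriv_halflineD f g df dg : deriv_halfline f df -> deriv_halfline g dg ->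
  deriv_halfline (fun t => f t + g t) (fun t => df t + dg t).
Proof.
move=> [fd fc] [gd gc]; split => [t t0|].
  by apply: is_deriveD; [exact: fd|exact: gd].
by move=> t; apply: cvgD; [exact: fc|exact: gc].
Qed.

Lemma deriv_halflineM f g df dg : deriv_halfline f df -> deriv_halfline g dg ->
  deriv_halfline (fun t => f t * g t) (fun t => f t * dg t + g t * df t).
Proof.
move=> [fd fc] [gd gc]; split => [t t0|].
  by apply: is_deriveM; [exact: fd|exact: gd].
by move=> t; apply: cvgM; [exact: fc|exact: gc].
Qed.

(** Differentiability of [h] is asked at [f 0] as well, where it yields the continuity of the
    composite at the end point. *)
Lemma deriv_halfline_comp h dh f df :
  (forall t, 0 <= t -> is_derive (f t) 1 h (dh t)) -> deriv_halfline f df ->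
  deriv_halfline (fun t => h (f t)) (fun t => dh t * df t).
Proof.
move=> hd [fd fc]; split => [t t0|].
  by apply: is_derive1_comp; [apply: hd; exact: ltW|exact: fd].
apply/subspace_continuousP => t At.
have t0 : 0 <= t by move: At; rewrite /= in_itv/= andbT.
apply: (@continuous_cvg _ _ _ _ _ f h); last by move/subspace_continuousP : fc; exact.
apply: differentiable_continuous; apply/derivable1_diffP.
exact: @ex_derive _ _ _ _ _ _ _ (hd _ t0).
Qed.

Lemma deriv_halflineN f df : deriv_halfline f df ->
  deriv_halfline (fun t => - f t) (fun t => - df t).
Proof.
move=> fd; have := deriv_halfline_comp (fun t _ => is_deriveNid (f t) 1) fd.
by apply: deriv_halfline_eq => t _; rewrite mulN1r.
Qed.

Lemma deriv_halflineV f df : (forall t, 0 <= t -> f t != 0) ->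
  deriv_halfline f df -> deriv_halfline (fun t => (f t)^-1) (fun t => - (f t ^- 2) * df t).
Proof.
move=> f0 fd; apply: deriv_halfline_comp fd => t t0.
have := is_deriveV (f0 _ t0) (is_derive_id (f t) 1).
by rewrite /= [_ *: 1]mulr1.
Qed.

Lemma deriv_halfline_ln f df : (forall t, 0 <= t -> 0 < f t) ->
  deriv_halfline f df -> deriv_halfline (fun t => ln (f t)) (fun t => (f t)^-1 * df t).
Proof.
by move=> f0; apply: deriv_halfline_comp => t t0; apply: is_derive1_ln; exact: f0.
Qed.

Lemma deriv_halfline_FTC f df t : {within `[0, +oo[, continuous df} ->
  deriv_halfline f df -> 0 <= t ->
  f t - f 0 = \int[lebesgue_measure]_(x in `[0, t]) df x.
Proof.
move=> cdf [fd fc]; rewrite le_eqVlt => /predU1P[<-|t0].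
  by rewrite subrr set_itv1 Rintegral_set1.
have sub : `[0, t] `<=` `[0, +oo[ by apply: subset_itvl; rewrite bnd_simp.
have cf : {within `[0, t], continuous f} by exact: continuous_subspaceW fc.
have [_ f0 ft] := (continuous_within_itvP f t0).1 cf.
rewrite /Rintegral (@continuous_FTC2 _ df f 0 t)//.
- exact: continuous_subspaceW cdf.
- split => // x; rewrite in_itv/= => /andP[x0 _].
  exact: @ex_derive _ _ _ _ _ _ _ (fd _ x0).
- move=> x; rewrite in_itv/= => /andP[x0 _].
  by rewrite derive1E; exact: @derive_val _ _ _ _ _ _ _ (fd _ x0).
Qed.

Lemma deriv_halfline_constant f t : deriv_halfline f (fun=> 0) -> 0 <= t -> f t = f 0.
Proof.
move=> fd t0; apply/eqP; rewrite -subr_eq0; apply/eqP.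
rewrite (deriv_halfline_FTC _ fd)//; last by move=> x; exact: cvg_cst.
by rewrite Rintegral_cst// mul0r.
Qed.

End halfline.

(** * Conservation laws and the exponential form of the six weights *)

Section modification.
Context {R : realType}.
Implicit Types (r s u ds dr : R -> R) (X : set R) (W : R -> R -> R).

(** The hypothesis says that half the derivative vanishes. It is used with [e = 1] for the circular
    flow and [e = -1] for the hyperbolic one. *)
Lemma quadratic_conserved s ds r dr (e : R) t :
  deriv_halfline s ds -> deriv_halfline r dr ->
  (forall t, 0 < t -> s t * ds t + e * (r t * dr t) = 0) -> 0 <= t ->
  s t ^+ 2 + e * r t ^+ 2 = s 0 ^+ 2 + e * r 0 ^+ 2.
Proof.
move=> sd rd sr0 t0; rewrite !expr2.
apply: (@deriv_halfline_constant _ (fun t => s t * s t + e * (r t * r t))) => //.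
have := deriv_halflineD (deriv_halflineM sd sd)
  (deriv_halflineM (deriv_halfline_cst e) (deriv_halflineM rd rd)).
apply: deriv_halfline_eq => x x0; rewrite mulr0 addr0.
by rewrite -(mulr0 2) -(sr0 _ x0); ring.
Qed.

(** For the discrete weights, [a] and [b] are the base of the power at times [t] and 0. *)
Lemma exprn_expR_ln (a b : R) n : 0 < a -> 0 < b ->
  a ^+ n = b ^+ n * expR ((ln a - ln b) * n%:R).
Proof.
move=> a0 b0; rewrite -{1}(lnK a0) -{1}(lnK b0) -!expRM_natr -expRD.
by rewrite mulrBl subrKC.
Qed.

(** The common target of the six cases: [L] is, up to a constant, the logarithm of the modification
    function, so the differential equation for it is linear. *)
Definition log_modification r u X W := exists (L : R -> R) (K : R),
  deriv_halfline L (fun t => K * (u t / r t)) /\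
  exists K_ : R -> R, forall t x, 0 <= t -> X x ->
    W t x = K_ t * W 0 x * expR ((L t - L 0) * x).

(** Since [p = (c + s) / (2 * c)] and [1 - p = (c - s) / (2 * c)], the weight is a binomial
    coefficient times a factor free of [n] times the [n]-th power of [(c + s) / (c - s)]. *)
Lemma krawtchouk_log_modification r s u X W :
  (forall t, 0 <= t -> 0 < r t) ->
  krawtchouk_case r s u X W -> log_modification r u X W.
Proof.
move=> r0 [/has_deriv_on_halfline sd /has_deriv_on_halfline rd _ [N [-> WE]]].
pose c := Num.sqrt (s 0 ^+ 2 + r 0 ^+ 2).
have cE t : 0 <= t -> Num.sqrt (s t ^+ 2 + r t ^+ 2) = c.
  move=> t0; congr Num.sqrt; rewrite -[X in _ + X = _]mul1r -[X in _ = _ + X]mul1r.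
  by apply: (quadratic_conserved sd rd) t0 => x _; ring.
have c2 t : 0 <= t -> r t ^+ 2 = (c + s t) * (c - s t).
  move=> t0; rewrite mulrC -subr_sqr -(cE _ t0) sqr_sqrtr; first by ring.
  by rewrite addr_ge0// sqr_ge0.
(* The inequality is strict because [r t] is positive; it makes both logarithms differentiable. *)
have cs t : 0 <= t -> `|s t| < c.
  move=> t0; rewrite -(cE _ t0) -sqrtr_sqr ltr_sqrt ?ltrDl ?exprn_gt0 ?r0//.
  by rewrite ltr_wpDl ?sqr_ge0// exprn_gt0 ?r0.
have cDs t : 0 <= t -> 0 < c + s t by move/cs; rewrite ltr_norml => /andP[]; lra.
have cBs t : 0 <= t -> 0 < c - s t by move/cs; rewrite ltr_norml => /andP[]; lra.
have c0 : 0 < c by rewrite (le_lt_trans _ (cs 0 _)).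
exists (fun t => ln (c + s t) - ln (c - s t)), (4 * c); split.
  have := deriv_halflineD
    (deriv_halfline_ln cDs (deriv_halflineD (deriv_halfline_cst c) sd))
    (deriv_halflineN (deriv_halfline_ln cBs
      (deriv_halflineD (deriv_halfline_cst c) (deriv_halflineN sd)))).
  apply: deriv_halfline_eq => t /ltW t0.
  have -> : u t / r t = u t * r t / ((c + s t) * (c - s t)).
    by rewrite -c2//; field; rewrite gt_eqF ?r0.
  by field; rewrite !gt_eqF ?cDs ?cBs.
exists (fun t => (c - s t) ^+ N / (c - s 0) ^+ N) => t _ t0 [n /= nN <-].
have {}WE x : 0 <= x -> W x n%:R = 'C(N, n)%:R / (2 * c) ^+ N * (c - s x) ^+ N *
    ((c + s x) / (c - s x)) ^+ n.
  move=> x0; rewrite WE//= cE//.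
  have -> : 2^-1 + s x / (2 * c) = (c + s x) / (2 * c) by field; rewrite gt_eqF.
  have -> : 1 - (c + s x) / (2 * c) = (c - s x) / (2 * c) by field; rewrite gt_eqF.
  (* Only the exponents [N] on the right are split as [(N - n) + n], to match the powers on the
     left. *)
  rewrite -{4 5}(subnK nN) !exprD !expr_div_n.
  by field; rewrite !expf_neq0// ?mulf_neq0 ?gt_eqF ?cBs.
have q0 x : 0 <= x -> 0 < (c + s x) / (c - s x) by move=> x0; rewrite divr_gt0 ?cDs ?cBs.
rewrite !WE// (exprn_expR_ln n (q0 _ t0) (q0 0 (lexx _))).
rewrite !ln_div ?posrE ?cDs ?cBs//.
by field; rewrite !expf_neq0// ?mulf_neq0 ?gt_eqF ?cBs.
Qed.

(** The root in [arccosh (s / r)] is [c / r], so [arccosh (s / r) = ln ((s + c) / r)] and the base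
    of the power is [expR (L t)]. *)
Lemma meixner_log_modification r s u X W :
  (forall t, 0 <= t -> 0 < r t) -> (forall t, 0 <= t -> 0 < s t) ->
  meixner_case r s u X W -> log_modification r u X W.
Proof.
move=> r0 s0 [[/has_deriv_on_halfline sd /has_deriv_on_halfline rd _] sr].
move=> [k [k0 -> WE]].
pose c := Num.sqrt (s 0 ^+ 2 - r 0 ^+ 2).
have c0 : 0 < c by rewrite sqrtr_gt0 sr.
have c2 t : 0 <= t -> c ^+ 2 = s t ^+ 2 - r t ^+ 2.
  move=> t0; rewrite sqr_sqrtr ?(ltW (sr _ _))// -!(mulN1r (r _ ^+ 2)); apply/esym.
  by apply: (quadratic_conserved sd rd) t0 => x _; ring.
(* This gives [expR (L t) < 1], so that the normalizing factor at time 0 can be divided out. *)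
have scr t : 0 <= t -> r t < s t + c.
  move=> t0; rewrite (@lt_trans _ _ (s t)) ?ltrDl// -(ltr_pXn2r (n:=2)) ?nnegrE ?ltW ?r0 ?s0//.
  by rewrite -subr_gt0 sr.
have sc0 t : 0 <= t -> 0 < s t + c by move=> t0; rewrite addr_gt0 ?s0.
pose L t := - 2 * (ln (s t + c) - ln (r t)).
exists L, (- 4 * c); split.
  have := deriv_halflineM (deriv_halfline_cst (- 2)) (deriv_halflineD
    (deriv_halfline_ln sc0 (deriv_halflineD sd (deriv_halfline_cst c)))
    (deriv_halflineN (deriv_halfline_ln r0 rd))).
  apply: deriv_halfline_eq => t /ltW t0.
  have r2 : r t ^+ 2 = (s t - c) * (s t + c).
    by rewrite -subr_sqr (c2 _ t0) subKr.
  (* Here [r ^+ 2 = (s - c) * (s + c)] clears [s + c] from the denominator; the terms in [s] then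
     cancel against those from [ln r]. *)
  have -> : (s t + c)^-1 * (- 2 * u t * r t + 0) = - 2 * u t * (s t - c) / r t.
    rewrite -(mulfK (lt0r_neq0 (sc0 _ t0)) (s t - c)) -r2.
    by field; rewrite !gt_eqF ?r0 ?sc0.
  by field; rewrite !gt_eqF ?r0.
have LE t : 0 <= t -> expR (- 2 * arccosh (s t / r t)) = expR (L t).
  move=> t0; rewrite /L -ln_div ?posrE ?sc0 ?r0//; congr (expR (_ * ln _)).
  have -> : (s t / r t) ^+ 2 - 1 = (c / r t) ^+ 2.
    by rewrite !expr_div_n (c2 _ t0); field; rewrite gt_eqF ?r0.
  by rewrite sqrtr_sqr ger0_norm ?divr_ge0 ?ltW ?r0// mulrDl.
have L1 t : 0 <= t -> 0 < 1 - expR (L t).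
  move=> t0; rewrite subr_gt0 expR_lt1 /L nmulr_rlt0// subr_gt0.
  by rewrite ltr_ln ?posrE ?r0 ?sc0 ?scr.
exists (fun t => (1 - expR (L t)) `^ (2 * k) / (1 - expR (L 0)) `^ (2 * k)).
move=> t _ t0 [n _ <-]; rewrite !WE//= !LE//.
rewrite (exprn_expR_ln n (expR_gt0 (L t)) (expR_gt0 (L 0))) !expRK.
by field; rewrite !gt_eqF ?powR_gt0 ?L1 ?ltr0n ?fact_gt0.
Qed.

(** Positivity turns [s ^+ 2 = r ^+ 2] into [s = r], so the equation for [r] closes up as
    [r' = - 2 * u * r]. *)
Lemma laguerre_log_modification r s u X W :
  (forall t, 0 <= t -> 0 < r t) -> (forall t, 0 <= t -> 0 < s t) ->
  laguerre_case r s u X W -> log_modification r u X W.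
Proof.
move=> r0 s0 [[_ /has_deriv_on_halfline rd _] sr [k [k0 -> WE]]].
have srE t : 0 <= t -> s t = r t.
  move=> t0; apply/eqP; rewrite -(eqrXn2 (n:=2)) ?ltW ?s0 ?r0//.
  by rewrite -subr_eq0 sr.
have rN0 t : 0 <= t -> r t != 0 by move=> t0; rewrite gt_eqF ?r0.
exists (fun t => - (r t)^-1), (- 2); split.
  apply: deriv_halfline_eq (deriv_halflineN (deriv_halflineV rN0 rd)) => t /ltW t0.
  by rewrite srE//; field; rewrite rN0.
exists (fun t => r t `^ (- (2 * k)) / r 0 `^ (- (2 * k))) => t x t0.
rewrite /= in_itv/= andbT => x0; rewrite !WE//.
have -> : - x / r t = - x / r 0 + (- (r t)^-1 - - (r 0)^-1) * x by ring.
(* With the inverse of the Gamma value as an atom, [field] does not ask for that value to be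
   nonzero. *)
rewrite expRD; set G := (rGamma _)^-1.
by field; rewrite gt_eqF ?powR_gt0 ?r0.
Qed.

(** The same conservation law is used with [r] and [s] exchanged. As
    [1 - (s / r) ^+ 2 = (c / r) ^+ 2], the derivative of the arccosine at [s / r] is [- r / c],
    while [s / r] has derivative [- 2 * u * c ^+ 2 / r ^+ 2]. *)
Lemma meixner_pollaczek_log_modification r s u X W :
  (forall t, 0 <= t -> 0 < r t) -> (forall t, 0 <= t -> 0 < s t) ->
  meixner_pollaczek_case r s u X W -> log_modification r u X W.
Proof.
move=> r0 s0 [[/has_deriv_on_halfline sd /has_deriv_on_halfline rd _] sr].
move=> [k [k0 -> WE]].
pose c := Num.sqrt (r 0 ^+ 2 - s 0 ^+ 2).
have c0 : 0 < c by rewrite sqrtr_gt0 -opprB oppr_gt0 sr.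
have c2 t : 0 <= t -> c ^+ 2 = r t ^+ 2 - s t ^+ 2.
  move=> t0; rewrite sqr_sqrtr; last by rewrite -opprB oppr_ge0 ltW ?sr.
  rewrite -!(mulN1r (s _ ^+ 2)); apply/esym.
  by apply: (quadratic_conserved rd sd) t0 => x _; ring.
have rN0 t : 0 <= t -> r t != 0 by move=> t0; rewrite gt_eqF ?r0.
have sr1 t : 0 <= t -> -1 < s t / r t < 1.
  move=> t0; rewrite (@lt_trans _ _ 0) ?divr_gt0 ?s0 ?r0//= ltr_pdivrMr ?r0// mul1r.
  rewrite -(ltr_pXn2r (n:=2)) ?nnegrE ?ltW ?r0 ?s0//.
  by rewrite -subr_lt0 sr.
exists (fun t => 2 * acos (s t / r t)), (4 * c); split.
  have := deriv_halflineM (deriv_halfline_cst 2)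
    (deriv_halfline_comp (fun t t0 => is_derive1_acos (sr1 t t0))
       (deriv_halflineM sd (deriv_halflineV rN0 rd))).
  apply: deriv_halfline_eq => t /ltW t0.
  have -> : 1 - (s t / r t) ^+ 2 = (c / r t) ^+ 2.
    by rewrite !expr_div_n (c2 _ t0); field; rewrite rN0.
  rewrite sqrtr_sqr ger0_norm ?divr_ge0 ?ltW ?r0//.
  rewrite mulr0 addr0 (_ : _ + _ = - 2 * u t * c ^+ 2 / r t ^+ 2).
    by field; rewrite rN0// gt_eqF.
  by rewrite (c2 _ t0); field; rewrite rN0.
(* The angle lies strictly between 0 and [pi], so the prefactor at time 0 is invertible. *)
have sin0 t : 0 <= t -> 0 < sin (acos (s t / r t)).
  move=> /sr1/andP[m1 p1]; apply: sin_gt0_pi.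
  by rewrite acos_gt0 ?acos_ltpi ?m1 ?p1 ?ltW.
exists (fun t => (2 * sin (acos (s t / r t))) `^ (2 * k) /
                 (2 * sin (acos (s 0 / r 0))) `^ (2 * k)) => t x t0 _.
rewrite !WE//.
have -> : (2 * acos (s t / r t) - pi) * x =
    (2 * acos (s 0 / r 0) - pi) * x +
    (2 * acos (s t / r t) - 2 * acos (s 0 / r 0)) * x by ring.
rewrite expRD; set D := (2 * pi * _)^-1; set G := _ ^+ 2.
by field; rewrite gt_eqF ?powR_gt0 ?mulr_gt0 ?sin0.
Qed.

(** The logarithm of [q] has derivative [2 * r' / r], and the factor [expR (- q t)] goes into
    [K_]. *)
Lemma charlier_log_modification r s u X W :
  (forall t, 0 <= t -> 0 < r t) ->
  charlier_case r s u X W -> log_modification r u X W.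
Proof.
move=> r0 [c c0 [_ /has_deriv_on_halfline rd _ [h [h0 -> WE]]]].
pose q t := h * r t ^+ 2 / (4 * c ^+ 2).
have c2 : 0 < 4 * c ^+ 2 by rewrite mulr_gt0// lt0r sqrf_eq0 c0 sqr_ge0.
have q0 t : 0 <= t -> 0 < q t by move=> t0; rewrite divr_gt0// mulr_gt0// exprn_gt0 ?r0.
exists (fun t => ln (q t)), (- 4 * c); split.
  have := deriv_halfline_ln q0 (deriv_halflineM (deriv_halflineM
    (deriv_halfline_cst h) (deriv_halflineM rd rd))
    (deriv_halfline_cst (4 * c ^+ 2)^-1)).
  apply: deriv_halfline_eq => t /ltW t0; rewrite /q.
  by field; rewrite c0 !gt_eqF ?r0.
exists (fun t => expR (- q t) / expR (- q 0)) => t _ t0 [n _ <-].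
rewrite !WE// -/(q t) -/(q 0) (exprn_expR_ln n (q0 _ t0) (q0 0 (lexx _))).
by field; rewrite !gt_eqF ?expR_gt0 ?ltr0n ?fact_gt0.
Qed.

(** With [r] constant, expanding [(x + h * s) ^+ 2] leaves a square in [x] free of [t], a cross term
    that gives [L], and a term in [s ^+ 2] that goes into [K_]. *)
Lemma hermite_log_modification r s u X W :
  (forall t, 0 <= t -> 0 < r t) ->
  hermite_case r s u X W -> log_modification r u X W.
Proof.
move=> r0 [/has_deriv_on_halfline sd /has_deriv_on_halfline rd _ [h [h0 -> WE]]].
have rE t : 0 <= t -> r t = r 0 by exact: deriv_halfline_constant.
have r00 : r 0 != 0 by rewrite gt_eqF ?r0.
exists (fun t => - (r 0 ^- 2) * s t), (- 2); split.
  apply: deriv_halfline_eq (deriv_halflineM (deriv_halfline_cst _) sd) => t /ltW t0.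
  by rewrite rE//; field.
exists (fun t => expR (h * (s 0 ^+ 2 - s t ^+ 2) / (2 * r 0 ^+ 2))) => t x t0 _.
rewrite !WE// rE//; set Z := (r 0 * _)^-1.
rewrite [_ * (Z * _)]mulrCA -!mulrA -!expRD; congr (_ * expR _).
by field; rewrite r00 gt_eqF.
Qed.

End modification.

(** * Assembly: exponentiating and integrating [L] *)

Theorem theorem7p1 (R : realType) (r s u : R -> R)
    (X : set R) (W : R -> R -> R)
    (r_C1 : C1_on `[0, +oo[ r) (s_C1 : C1_on `[0, +oo[ s)
    (u_C0 : C0_on `[0, +oo[ u)
    (r_gt0 : forall t, 0 <= t -> 0 < r t)
    (s_gt0 : forall t, 0 <= t -> 0 < s t)
    (cases : krawtchouk_case r s u X W \/
             meixner_case r s u X W \/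
             laguerre_case r s u X W \/
             meixner_pollaczek_case r s u X W \/
             charlier_case r s u X W \/
             hermite_case r s u X W) :
  exists m : R -> R,
    [/\ (forall t, 0 <= t -> 0 < m t),
        m 0 = 1,
        (exists K_ : R -> R, forall t x, 0 <= t -> X x ->
           W t x = K_ t * W 0 x * m t `^ x) &
        (exists K : R, forall t, 0 <= t ->
           m t = expR (K * \int[lebesgue_measure]_(tau in `[0, t]) (u tau / r tau)))].
Proof.
have : log_modification r u X W.
  case: cases => [|[|[|[|[]]]]].
  - exact: krawtchouk_log_modification.
  - exact: meixner_log_modification.
  - exact: laguerre_log_modification.
  - exact: meixner_pollaczek_log_modification.
  - exact: charlier_log_modification.
  - exact: hermite_log_modification.
move=> [L [K [dL [K_ WE]]]].
have cr : {within `[0, +oo[, continuous r}.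
  by case: r_C1 => dr /has_deriv_on_continuous.
(* This continuity serves twice: for the fundamental theorem and for the integrability needed to
   pull [K] out of the integral. *)
have cur : {within `[0, +oo[, continuous (fun t => u t / r t)}.
  apply/subspace_continuousP => t; rewrite /= in_itv/= andbT => t0.
  have At : `[0, +oo[%classic t by rewrite /= in_itv/= andbT.
  apply: cvgM; first by move/subspace_continuousP : u_C0; exact.
  apply: cvgV; first by rewrite gt_eqF ?r_gt0.
  by move/subspace_continuousP : cr; exact.
exists (fun t => expR (L t - L 0)); split.
- by move=> t _; exact: expR_gt0.
- by rewrite subrr expR0.
(* A real power of an exponential is the exponential of the product. *)
- by exists K_ => t x t0 Xx; rewrite -expRM; exact: WE.
- exists K => t t0; congr expR; rewrite (deriv_halfline_FTC _ dL)//.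
    rewrite RintegralZl//; apply: continuous_compact_integrable.
      exact: segment_compact.
    by apply: continuous_subspaceW cur; apply: subset_itvl; rewrite bnd_simp.
  by move=> t'; apply: cvgM; [exact: cvg_cst | exact: cur].
Qed.
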